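(* Let $G$ be a locally compact group that can be written as $G = \bigcup_n K_n$ where $K_n < G$ is an increasing sequence of compact open subgroups. There exists a $1$-cocycle $c : G \to L^2_{\mathbb{R}}(G)$ for the left regular representation of $G$ such that $$\delta := \limsup_{s\to+\infty}\frac{\log\lambda(\{g \in G \mid \|c(g)\| \leq s\})}{\log s} = 0$$ (where $\lambda$ is the Haar measure on $G$) and the skew product action $\beta$ associated with $c$ is dissipative.
   Context: Locally compact groups are second countable; Hilbert spaces are separable. Let $H=L^2_{\mathbb R}(G)$ and let $\pi$ be the left regular representation of $G$ on $H$. A $1$-cocycle satisfies $c(gh)=c(g)+\pi(g)c(h)$. Gaussian construction: $(\widehat H,\mu)$ is the (essentially unique) standard probability space equipped with a linear map $\xi\mapsto\langle\,\cdot\,,\xi\rangle$ from $H$ to real random variables such that each $\langle\,\cdot\,,\xi\rangle$ is centered Gaussian with variance $\|\xi\|^2$ and these generate the $\sigma$-algebra. $\widehat\pi(g)$ is the $\mu$-preserving automorphism of $\widehat H$ with $\langle\widehat\pi(g)\omega,\pi(g)\xi\rangle=\langle\omega,\xi\rangle$ a.e. for all $\xi$. The skew product action is $\beta:G\curvearrowright\widehat H\times\mathbb R$, $\beta_g(\omega,t)=(\widehat\pi(g)\omega,\ t+\langle\omega,c(g^{-1})\rangle)$, preserving $\mu\otimes\mathrm{Leb}$. A nonsingular action of $G$ on a $\sigma$-finite standard measure space $X$ is dissipative if, for an equivalent probability measure $\nu$ and left Haar measure $\lambda$, $\int_G\frac{d(g^{-1}\nu)}{d\nu}(x)\,d\lambda(g)<+\infty$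 for a.e. $x$. *)

(* Defs.v *)
From HB Require Import structures.
From mathcomp Require Import all_boot all_order all_algebra.
From mathcomp Require Import all_classical all_reals all_analysis.
From mathcomp Require Import measurable_realfun.

Set Implicit Arguments.
Unset Strict Implicit.
Unset Printing Implicit Defensive.

Import Order.TTheory GRing.Theory Num.Theory.
Import numFieldNormedType.Exports.

Local Open Scope classical_set_scope.
Local Open Scope ring_scope.

HB.mixin Record isBorelTopologicalGroup d G
    of Group G & Topological G & Measurable d G := {
  mulg_continuous : continuous (fun z : G * G => (z.1 * z.2)%g) ;
  invg_continuous : continuous (fun x : G => (x^-1)%g) ;
  measurable_borel : @measurable d G = <<s @open G >>
}.

(* Topological groups equipped with their Borel sigma-algebra. *)
#[short(type="topologicalGroupType")]
HB.structure Definition TopologicalGroup d :=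
  {G of Group G & Topological G & Measurable d G & isBorelTopologicalGroup d G}.

Definition lcsc_group (d : measure_display) (G : topologicalGroupType d) : Prop :=
  [/\ hausdorff_space G, locally_compact [set: G] & @second_countable G].

Definition is_subgroup (G : groupType) (K : set G) : Prop :=
  [/\ K 1%g, (forall x y, K x -> K y -> K (x * y)%g)
    & (forall x, K x -> K (x^-1)%g)].

Section haar.
Context (R : realType) (d : measure_display) (G : topologicalGroupType d).
Implicit Types lam : {measure set G -> \bar R}.

(* On a locally compact second countable group a Borel measure that is finite
   on compact sets is automatically regular. *)
Record left_haar lam : Prop := LeftHaar {
  left_haar_neq0 : lam [set: G] != 0%E ;
  left_haar_compact : forall K : set G, compact K -> (lam K < +oo)%E ;
  left_haar_invariant : forall (g : G) (A : set G), measurable A ->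
    lam [set (g * x)%g | x in A] = lam A
}.

(* Elements of L^2_R(G) are represented by square-integrable functions; they
   are compared up to equality lam-almost everywhere. *)
Definition L2 lam := LfunType lam (lee1n 2 : (1 <= 2%:E)%E).

Definition L2norm lam (f : L2 lam) : R := fine ('N[lam]_(2%:E)[EFin \o f])%E.

Definition left_translate (g : G) (f : G -> R) : G -> R :=
  fun x => f (g^-1 * x)%g.

Lemma measurable_mulg (g : G) : measurable_fun [set: G] (fun x : G => (g * x)%g).
Proof.
apply: (measurability _ measurable_borel) => _ [U oU <-].
rewrite setTI measurable_borel; apply: sub_sigma_algebra.
suff : continuous (fun x : G => (g * x)%g) by move/continuousP; apply.
move=> x; apply: (@cvg_comp _ _ _ (fun x : G => (g, x))
  (fun z : G * G => (z.1 * z.2)%g) _ (nbhs (g, x)) _).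
  by apply: cvg_pair; [exact: cvg_cst|exact: cvg_id].
exact: (mulg_continuous (g, x)).
Qed.

Lemma left_translate_Lfun lam (hl : left_haar lam) (g : G) (f : L2 lam) :
  left_translate g f \in Lfun lam 2%:E.
Proof.
have mT := measurable_mulg (g^-1)%g.
have mf : measurable_fun [set: G] f by exact: measurable_funPT.
apply/andP; split; rewrite inE/=.
  exact: (measurableT_comp mf mT).
have := @Lfunction_finite _ _ _ _ _ _ f; rewrite /finite_norm.
suff -> : ('N[lam]_2%:E[EFin \o left_translate g f] =
           'N[lam]_2%:E[EFin \o f])%E by [].
rewrite unlock; congr (_ `^ _)%E.
have mh : measurable_fun [set: G] (fun x : G => `|(f x)%:E| `^ 2)%E.
  apply: (measurableT_comp (measurable_poweR _)).
  by apply: measurableT_comp => //; exact/measurable_EFinP.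
have := @ge0_integral_pushforward _ _ _ _ R _ mT lam setT _
  measurableT mh (fun _ _ => poweR_ge0 _ _).
rewrite preimage_setT => <-.
apply: eq_measure_integral => A mA _.
rewrite /pushforward/= -[LHS](left_haar_invariant hl (g^-1)%g)//; last first.
  by rewrite -[_ @^-1` _]setTI; exact: mT.
congr (lam _); apply/seteqP; split => [_ [x Ax <-]//|x Ax].
by exists (g * x)%g; rewrite /= ?monoid.mulKg.
Qed.

(* The left regular representation: (pi(g) f)(x) = f(g^-1 x). *)
Definition regular_rep lam (hl : left_haar lam) (g : G) (f : L2 lam) : L2 lam :=
  Lfun_Sub _ (left_translate_Lfun hl g f).

Definition L2_continuous lam (c : G -> L2 lam) : Prop :=
  forall g : G, (fun h => L2norm (c h - c g)) @ g --> (0 : R).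

Definition is_cocycle lam (hl : left_haar lam) (c : G -> L2 lam) : Prop :=
  L2_continuous c /\ forall g h,
    {ae lam, forall x, c (g * h)%g x = (c g + regular_rep hl g (c h)) x}.

(* limsup_(s -> +oo) log lam{g | `|c g| <= s} / log s, as an extended real. *)
Definition growth_exponent lam (c : G -> L2 lam) : \bar R :=
  limf_esup
    (fun s : R => (lne (lam [set g | (L2norm (c g) <= s)%R]) * ((ln s)^-1)%:E)%E)
    (+oo : set_system R).

End haar.

(* Measurably isomorphic to a Polish space with its Borel sigma-algebra. *)
Definition standard_borel (R : realType) (d : measure_display)
    (T : measurableType d) : Prop :=
  exists P : completePseudoMetricType R,
    [/\ hausdorff_space P, (exists2 D : set P, countable D & dense D)
      & exists2 f : T -> P, bijective f &
          forall A : set T, measurable A <-> <<s @open P >> (f @` A)].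

(* `normal_prob 0 0` is the uniform law on [0, 1], hence the case split. *)
Definition centered_gaussian (R : realType) (s : R) : set R -> \bar R :=
  if s == 0 then \d_(0 : R) else normal_prob 0 s.

(* Automorphisms of a probability space, modulo null sets. *)
Definition mp_automorphism (R : realType) (d : measure_display)
    (T : measurableType d) (mu : probability T R) (phi : T -> T) : Prop :=
  [/\ measurable_fun [set: T] phi,
      (forall A, measurable A -> mu (phi @^-1` A) = mu A)
    & exists psi : T -> T, [/\ measurable_fun [set: T] psi,
        {ae mu, forall w, psi (phi w) = w}
      & {ae mu, forall w, phi (psi w) = w}]].

Section gaussian.
Context (R : realType) (d : measure_display) (G : topologicalGroupType d).
Context (lam : {measure set G -> \bar R}) (hl : left_haar lam).
Context (d' : measure_display) (W : measurableType d') (mu : probability W R).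

(* [J xi] is the random variable written <., xi>; [J] descends to classes modulo
   null functions because [J (xi - eta)] has variance `|xi - eta|^2. *)
Record gaussian_construction (J : L2 lam -> {mfun W >-> R}) : Prop :=
  GaussianConstruction {
  gaussian_standard : standard_borel R W ;
  gaussian_linear : forall (a : R) (xi eta : L2 lam),
    {ae mu, forall w, J (a *: xi + eta) w = a * J xi w + J eta w} ;
  gaussian_law : forall (xi : L2 lam) (A : set R), measurable A ->
    mu (J xi @^-1` A) = centered_gaussian (L2norm xi) A ;
  (* the J xi generate the sigma-algebra modulo null sets *)
  gaussian_generate : forall A : set W, measurable A ->
    exists2 B, <<s [set J z.1 @^-1` z.2 | z in [set z : L2 lam * set R |
                    measurable z.2]] >> B
      & mu ((A `\` B) `|` (B `\` A)) = 0%E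
}.

Definition gaussian_action (J : L2 lam -> {mfun W >-> R}) (pih : G -> W -> W) :
    Prop :=
  forall g : G, mp_automorphism mu (pih g) /\
    (forall xi : L2 lam,
      {ae mu, forall w, J (regular_rep hl g xi) (pih g w) = J xi w}).

Definition skew_product (J : L2 lam -> {mfun W >-> R}) (pih : G -> W -> W)
    (c : G -> L2 lam) (g : G) (z : W * measurableTypeR R) :
    W * measurableTypeR R :=
  (pih g z.1, z.2 + J (c g^-1%g) z.1).

End gaussian.

(* [D] is a jointly measurable version of the Radon-Nikodym derivatives
   D (g, .) = d(g^-1 nu)/dnu, where g^-1 nu is the image of nu by [T g^-1].
   Such a version is unique up to a null set of G * X, so the condition does
   not depend on its choice. *)
Definition dissipative (R : realType) (d : measure_display)
    (G : topologicalGroupType d) (lam : {measure set G -> \bar R})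
    (d' : measure_display) (X : measurableType d')
    (m : {measure set X -> \bar R}) (T : G -> X -> X) : Prop :=
  exists nu : probability X R, [/\ nu `<< m, m `<< nu &
    exists D : G * X -> \bar R,
      [/\ measurable_fun [set: G * X] D,
          (forall z, 0 <= D z)%E,
          (forall (g : G) (A : set X), measurable A ->
            nu (T g^-1%g @^-1` A) = (\int[nu]_(x in A) D (g, x))%E)
        & {ae m, forall x, (\int[lam]_g D (g, x) < +oo)%E}]].

(* Main.v *)
(* Let n(x) be the least n with x in K_n. The cocycle is the formal coboundary
   c(g) = pi(g)F - F of F = b o n, where b : N -> R grows very fast; F itself is
   not square-integrable, but c(g) is supported in K_(n(g)) because
   n(g^-1 x) = n(x) as soon as n(x) > n(g). Moreover c is right K_0-invariant,
   hence locally constant, and if n(g) = n + 1 then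
   |c(g)| >= (b_(n+1) - b_n) sqrt(lam(K_0)). Choosing b so that this is
   r_m = (2 (1 + lam(K_m)))^m for m = n(g) gives growth exponent 0, since
   lam(K_m)^k <= r_m for all m >= k.

   For dissipativity take nu = mu (x) N(0,1), with density phi(t) for mu (x) Leb.
   As beta_g preserves mu (x) Leb, d(g^-1 nu)/dnu (w,t) is
   phi(t + J(c(g^-1))(w)) / phi(t). Since J(c(g^-1)) is N(0,s^2) with
   s = |c(g^-1)|, averaging phi(t + J(c(g^-1))) over w gives at most
   1/s <= 1/r_(n(g)), and sum_m lam(K_m)/r_m < oo; conclude by Tonelli. *)

Require Import Defs.
From HB Require Import structures.
From mathcomp Require Import all_boot all_order all_algebra.
From mathcomp Require Import all_classical all_reals all_analysis.
From mathcomp Require Import measurable_realfun ring lra.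

Set Implicit Arguments.
Unset Strict Implicit.
Unset Printing Implicit Defensive.

Import Order.TTheory GRing.Theory Num.Theory.
Import numFieldNormedType.Exports.

Local Open Scope classical_set_scope.
Local Open Scope ring_scope.

(** * Densities and Gaussian averages *)

Section density_dominates.
Context d (T : measurableType d) (R : realType).
Variables (mu : {measure set T -> \bar R}) (P : probability T R).
Variable p : T -> R.
Hypothesis mp : measurable_fun [set: T] p.
Hypothesis Pp : forall A, measurable A -> P A = (\int[mu]_(x in A) (p x)%:E)%E.

Lemma density_null_dominates : P `<< mu.
Proof.
apply/null_content_dominatesP => A mA muA; rewrite Pp//.
by apply: null_set_integral => //; exact/measurable_EFinP/measurable_funTS.
Qed.

(** If [P A = 0], the density vanishes almost everywhere on [A]; being positive everywhere, it
    leaves no room for [A] outside a null set. *)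
Lemma null_dominates_density : (forall x, 0 < p x) -> mu `<< P.
Proof.
move=> pgt0; have p0 x : 0 <= p x by exact: ltW.
apply/null_content_dominatesP => A mA PA; have := Pp mA; rewrite [LHS]PA => PA0.
have mpA : measurable_fun A (EFin \o p).
  exact/measurable_EFinP/measurable_funTS.
have [+ _] := ae_eq_integral_abs mu mA mpA.
under eq_integral do rewrite gee0_abs ?lee_fin//.
move=> /(_ (esym PA0)) [N [mN N0 AN]]; apply: subset_measure0 mN _ N0 => //.
move=> x Ax; apply: AN => /= /(_ Ax) [] px0.
by have := pgt0 x; rewrite px0 ltxx.
Qed.

End density_dominates.

Section density.
Context d (T : measurableType d) (R : realType).
Variables (mu : {sigma_finite_measure set T -> \bar R}) (P : probability T R).
Variable p : T -> R.
Hypotheses (mp : measurable_fun [set: T] p) (p0 : forall x, 0 <= p x).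
Hypothesis Pp : forall A, measurable A -> P A = (\int[mu]_(x in A) (p x)%:E)%E.

(** Both [p] and the Radon-Nikodym derivative of [P] are integrable with the same integrals over
    measurable sets, so they agree almost everywhere, and change of variables for the latter
    transfers to [p]. *)
Lemma ge0_integral_density (f : T -> \bar R) (E : set T) : measurable E ->
  measurable_fun E f -> (forall x, 0 <= f x)%E ->
  (\int[P]_(x in E) f x = \int[mu]_(x in E) (f x * (p x)%:E))%E.
Proof.
move=> mE mf f0; have Pmu := density_null_dominates mp Pp.
rewrite -(Radon_Nikodym_SigmaFinite.change_of_variables Pmu)//.
have mg := measurable_int _ (Radon_Nikodym_SigmaFinite.f_integrable Pmu).
have mpE : measurable_fun [set: T] (fun x => (p x)%:E).
  exact/measurable_EFinP.
have intp : mu.-integrable [set: T] (fun x => (p x)%:E).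
  apply/integrableP; split=> //.
  under eq_integral do rewrite gee0_abs ?lee_fin//.
  by rewrite -Pp// probability_setT ltry.
apply: ge0_ae_eq_integral => //.
- by apply: emeasurable_funM => //; exact: measurable_funTS.
- by apply: emeasurable_funM => //; exact: measurable_funTS.
- by move=> x _; rewrite mule_ge0// Radon_Nikodym_SigmaFinite.f_ge0.
- by move=> x _; rewrite mule_ge0// lee_fin.
- apply: ae_eqe_mul2l; apply: (@ae_eq_subset _ _ _ _ _ [set: T]) => //.
  apply: integral_ae_eq => //.
    exact: Radon_Nikodym_SigmaFinite.f_integrable.
  by move=> A _ mA; rewrite -Radon_Nikodym_SigmaFinite.f_integral//; exact: Pp.
Qed.

End density.

(** * Translation invariance of Lebesgue measure *)

Section lebesgue_translation.
Context (R : realType).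
Notation mu := (@lebesgue_measure R).

Lemma lebesgue_measureD (a : R) (A : set R) : measurable A ->
  pushforward mu (+%R^~ a : _ -> measurableTypeR R) A = mu A.
Proof.
move=> mA; apply/esym/lebesgue_measure_unique => //=.
  exact: measurable_funD.
move=> _ _ [[b c]] _ <-.
have -> : pushforward mu (+%R^~ a : _ -> measurableTypeR R) `]b, c]%classic
    = mu `]b - a, c - a]%classic.
  rewrite /pushforward; congr (mu _); apply/seteqP; split => x /=;
  by rewrite !in_itv/= ltrBlDr lerBrDr.
rewrite !lebesgue_measure_itv/= !lte_fin ltrD2r; case: ifP => // _.
by rewrite -!EFinD; congr EFin; ring.
Qed.

Lemma ge0_integral_translation (a : R) (f : R -> \bar R) :
  measurable_fun [set: R] f -> (forall r, 0 <= f r)%E ->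
  (\int[mu]_x f (x + a)%R = \int[mu]_x f x)%E.
Proof.
move=> mf f0.
have ma : measurable_fun [set: measurableTypeR R]
  (+%R^~ a : _ -> measurableTypeR R) by exact: measurable_funD.
transitivity (\int[pushforward mu (+%R^~ a : _ -> measurableTypeR R)]_x f x)%E.
  by rewrite ge0_integral_pushforward// preimage_setT.
by apply: eq_measure_integral => A mA _; exact: lebesgue_measureD.
Qed.

End lebesgue_translation.

(** * Averages of the standard normal density against centered Gaussians *)

Section normal_bound.
Context (R : realType).

Lemma normal_pdf_gt0 (m s x : R) : s != 0 -> 0 < normal_pdf m s x.
Proof. by move=> s0; rewrite normal_pdfE// mulr_gt0 ?expR_gt0 ?normal_peak_gt0. Qed.

Lemma normal_peak_le (s : R) : 0 < s -> normal_peak s <= s^-1.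
Proof.
move=> s0; have pi1 : 1 <= pi *+ 2 :> R.
  by rewrite mulr2n (le_trans _ (lerD (pi_ge2 R) (pi_ge2 R)))//; lra.
rewrite /normal_peak lef_pV2 ?posrE ?sqrtr_gt0 -?mulrnAr//; last first.
  by rewrite mulr_gt0 ?exprn_gt0// (lt_le_trans _ pi1).
by rewrite -{1}(gtr0_norm s0) -sqrtr_sqr ler_wsqrtr// ler_peMr ?sqr_ge0.
Qed.

(** The density of N(0,s^2) is at most its peak, hence at most 1/s; what remains is a translate of
    the standard density, of total integral 1. *)
Lemma normal_smoothing_bound (s t : R) : 0 < s ->
  (\int[normal_prob 0 s]_y (normal_pdf 0 1 (t + y))%:E <= (s^-1)%:E)%E.
Proof.
move=> s0; have mpdf : measurable_fun [set: measurableTypeR R]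
    (fun y : measurableTypeR R => (normal_pdf 0 1 (t + y))%:E).
  apply/measurable_EFinP; apply: measurableT_comp.
    exact: measurable_normal_pdf.
  exact: measurable_funD.
rewrite (@ge0_integral_density _ _ _ lebesgue_measure _ (normal_pdf 0 s))//=.
- apply: (@le_trans _ _ (\int[lebesgue_measure]_y
    ((normal_pdf 0 1 (t + y))%:E * (s^-1)%:E))%E).
    apply: ge0_le_integral => //.
    + by move=> x _; rewrite mule_ge0// lee_fin normal_pdf_ge0.
    + apply: emeasurable_funM => //; apply/measurable_EFinP.
      exact: measurable_normal_pdf.
    + exact: emeasurable_funM.
    + move=> x _; rewrite lee_wpmul2l// ?lee_fin ?normal_pdf_ge0//.
      by rewrite (le_trans (normal_pdf_ub _ _ _)) ?gt_eqF ?normal_peak_le.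
  rewrite ge0_integralZr// ?lee_fin ?invr_ge0 ?(ltW s0)//; last first.
    by move=> x _; rewrite lee_fin normal_pdf_ge0.
  under eq_integral do rewrite addrC.
  rewrite (ge0_integral_translation t (f := fun x => (normal_pdf 0 1 x)%:E)).
  - by rewrite integral_normal_pdf mul1e.
  - by apply/measurable_EFinP; exact: measurable_normal_pdf.
  - by move=> x; rewrite lee_fin normal_pdf_ge0.
- exact: measurable_normal_pdf.
- by move=> x; exact: normal_pdf_ge0.
- by move=> x; rewrite lee_fin normal_pdf_ge0.
Qed.

End normal_bound.

(** * Skew products over a probability space *)

(** Sets invariant under [S] up to a null set form a sigma-algebra, since a countable union involves
    only countably many exceptional null sets. *)
Lemma ae_invariant_generated d (T : measurableType d) (R : realType)
    (mu : {measure set T -> \bar R}) (S : T -> T) (C : set (set T)) :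
  (forall A, C A -> {ae mu, forall x, A (S x) <-> A x}) ->
  forall A, <<s C >> A -> {ae mu, forall x, A (S x) <-> A x}.
Proof.
move=> CS; pose D : set (set T) := [set A | {ae mu, forall x, A (S x) <-> A x}].
suff : <<s C >> `<=` D by [].
apply: smallest_sub => //; split.
- exact: aeW.
- rewrite /D/= => A; apply: filterS => x Ax.
  by split=> -[_ nA]; split=> // /Ax.
- rewrite /D/= => A /ae_foralln; apply: filterS => x Ax.
  by split=> -[n _ /Ax ?]; exists n.
Qed.

(** Basic open sets on which [f] is constant in [g] cover [G] and are countably many, so a preimage
    is a countable union of measurable rectangles. *)
Lemma measurable_locally_constant d (G : topologicalGroupType d)
    d1 d2 (T1 : measurableType d1) (T2 : measurableType d2)
    (f : G -> T1 -> T2) : @second_countable G ->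
  (forall g, \forall h \near g, f h = f g) ->
  (forall g, measurable_fun [set: T1] (f g)) ->
  measurable_fun [set: G * T1] (fun z => f z.1 z.2).
Proof.
move=> [B cB [Bo Bb]] flc mf _ Y mY; rewrite setTI.
pose B' := [set b | B b /\ forall g h, b g -> b h -> f g = f h].
have cB' : countable [set: B'].
  rewrite (eq_countable (card_setT _)).
  by apply: sub_countable cB; apply: subset_card_le => b [].
pose F (b : set G) := b `*` [set t | exists2 g, b g & Y (f g t)].
suff -> : (fun z : G * T1 => f z.1 z.2) @^-1` Y = \bigcup_(b : B') F (val b).
  apply: countable_bigcupT_measurable => // -[b /= /set_mem[Bb' fb]].
  apply: measurableX.
    rewrite measurable_borel; apply: sub_sigma_algebra; exact: Bo.
  have [->|/set0P[g bg]] := eqVneq b set0.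
    rewrite (_ : [set _ | _] = set0)//.
    by apply/seteqP; split => // t [].
  rewrite (_ : [set _ | _] = [set: T1] `&` f g @^-1` Y); first exact: mf.
  rewrite setTI; apply/seteqP; split => t /=.
    by move=> [h bh]; rewrite (fb _ _ bh bg).
  by exists g.
apply/seteqP; split => [[g t] /= Yfg|[g t] [[b /= bB]] _ [/= bg [h bh Yfh]]].
  have [b [Bb' bg] bf] := Bb g _ (flc g).
  have bB' : b \in B'.
    apply/mem_set; split=> // h k bh bk.
    by rewrite (bf _ bh) (bf _ bk).
  by exists (exist _ b bB') => //; split => //; exists g.
by have [_ bf] := set_mem bB; rewrite (bf _ _ bg bh).
Qed.

Lemma limf_esup_eq0 (R : realType) (f : R -> \bar R) (F : set_system R) :
  ProperFilter F ->
  (forall e : R, 0 < e -> F [set s | (- e%:E <= f s <= e%:E)%E]) ->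
  limf_esup f F = 0%E.
Proof.
move=> FF fF; apply/eqP; rewrite eq_le; apply/andP; split.
  apply/lee_addgt0Pr => e e0; rewrite add0e.
  apply: (@le_trans _ _ (ereal_sup (f @` [set s | (- e%:E <= f s <= e%:E)%E]))).
    apply: ereal_inf_lbound; exists [set s | (- e%:E <= f s <= e%:E)%E] => //.
    exact: fF.
  by apply: ge_ereal_sup => _ [s /= /andP[_ ?] <-].
apply/lee_addgt0Pr => e e0.
(* Lower bound: by properness every [V] in the filter meets the set where [f >= - e], so its
   supremum is at least [- e]. *)
rewrite -leeBlDr// sub0e.
apply: le_ereal_inf_tmp => _ [V FV <-].
have [s [Vs /= /andP[fs _]]] := filter_ex (filterI FV (fF _ e0)).
by apply: le_trans fs _; apply: ereal_sup_ubound; exists s.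
Qed.

Section skew_product.
Context d (W : measurableType d) (R : realType) (mu : probability W R).
Notation leb := (@lebesgue_measure R).
Notation X := (W * measurableTypeR R)%type.
Notation m := (mu \x leb)%E.

(** The shape of beta_g for one fixed [g]: [p] stands for [pih g] and [Y] for the Gaussian variable
    of c(g^-1). *)
Definition skew_map (p : W -> W) (Y : W -> R) (z : X) : X := (p z.1, z.2 + Y z.1).

Lemma measurable_skew (p : W -> W) (Y : W -> R) :
  measurable_fun [set: W] p -> measurable_fun [set: W] Y ->
  measurable_fun [set: X] (skew_map p Y).
Proof.
move=> mp mY; apply/measurable_fun_pair => /=.
  exact: measurableT_comp.
by apply: measurable_funD => //; exact: measurableT_comp.
Qed.

(** For fixed [w] the second coordinate is only translated by [Y w], which Lebesgue measure ignores;
    the remaining function of [p w] is handled by preservation of [mu]. *)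
Lemma ge0_integral_skew (p : W -> W) (Y : W -> R) (f : X -> \bar R) :
  measurable_fun [set: W] p -> measurable_fun [set: W] Y ->
  (forall A, measurable A -> mu (p @^-1` A) = mu A) ->
  measurable_fun [set: X] f -> (forall z, 0 <= f z)%E ->
  (\int[m]_z f (skew_map p Y z) = \int[m]_z f z)%E.
Proof.
move=> mp mY pmu mf f0.
rewrite fubini_tonelli1//; last first.
  by apply: measurableT_comp => //; exact: measurable_skew.
rewrite fubini_tonelli1// /fubini_F /skew_map/=.
under eq_integral => w _.
  rewrite (ge0_integral_translation (Y w) (f := fun t => f (p w, t)))//.
    over.
  by apply: measurableT_comp => //; exact: pair1_measurable.
pose h w := (\int[leb]_t f (w, t))%E.
have mh : measurable_fun [set: W] h by exact: measurable_fun_fubini_tonelli_F.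
have h0 w : (0 <= h w)%E by exact: integral_ge0.
transitivity (\int[pushforward mu p]_w h w)%E.
  by rewrite ge0_integral_pushforward// preimage_setT.
by apply: eq_measure_integral => A mA _; exact: pmu.
Qed.

Lemma ae_fst (P : W -> Prop) :
  {ae mu, forall w, P w} -> {ae m, forall z, P z.1}.
Proof.
move=> [N [mN N0 PN]]; exists (N `*` [set: R]); split.
- exact: measurableX.
- by rewrite product_measure1E// [X in (X * _)%E]N0 mul0e.
- by move=> z /= nP; split => //; exact: PN.
Qed.

(** Here [p] is the identity only as seen by measurable sets, so the conclusion is also about sets;
    rectangles suffice because they generate the product sigma-algebra. *)
Lemma ae_skew_id (p : W -> W) (Y : W -> R) :
  (forall A, measurable A -> {ae mu, forall w, A (p w) <-> A w}) ->
  {ae mu, forall w, Y w = 0} ->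
  forall A, measurable A -> {ae m, forall z, A (skew_map p Y z) <-> A z}.
Proof.
move=> pA Y0 A; rewrite measurable_prod_measurableType.
apply: ae_invariant_generated => _ [A1 mA1] [A2 mA2] <-.
have := ae_fst Y0; have := ae_fst (pA _ mA1).
apply: filterS2 => -[w t] /= pw Yw; rewrite /skew_map/= Yw addr0.
by split=> -[/= /pw ? ?].
Qed.

Lemma ae_preserving (p : W -> W) (P : W -> Prop) :
  measurable_fun [set: W] p ->
  (forall A, measurable A -> mu (p @^-1` A) = mu A) ->
  {ae mu, forall w, P w} -> {ae mu, forall w, P (p w)}.
Proof.
move=> mp pmu [N [mN N0 PN]]; exists (p @^-1` N); split.
- by rewrite -[_ @^-1` _]setTI; exact: mp.
- by rewrite pmu.
- by move=> w /= nP; exact: PN.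
Qed.

(** The density of mu (x) N(0,1) with respect to mu (x) Leb. *)
Definition gauss_density (z : X) : R := normal_pdf 0 1 z.2.

Lemma measurable_gauss_density : measurable_fun [set: X] gauss_density.
Proof.
apply: (measurableT_comp (f := normal_pdf 0 1)) => //.
exact: measurable_normal_pdf.
Qed.

Lemma gauss_density_gt0 z : 0 < gauss_density z.
Proof. exact: normal_pdf_gt0. Qed.

Lemma gauss_density_ge0 z : 0 <= gauss_density z.
Proof. exact/ltW/gauss_density_gt0. Qed.

Lemma measurable_gauss_densityV :
  measurable_fun [set: X] (fun z => (gauss_density z)^-1).
Proof.
apply: (measurableT_comp (f := fun t => (normal_pdf 0 1 t)^-1)) => //.
apply: continuous_measurable_fun => t; apply: cvgV.
  by rewrite gt_eqF// normal_pdf_gt0.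
exact: continuous_normal_pdf.
Qed.

Lemma product_normal_prob_density (A : set X) : measurable A ->
  (mu \x normal_prob 0 1)%E A = (\int[m]_(z in A) (gauss_density z)%:E)%E.
Proof.
move=> mA; have mgd := measurable_gauss_density.
rewrite integral_mkcond fubini_tonelli1//; last 2 first.
- apply/(measurable_restrictT _ _).1 => //.
  exact/measurable_EFinP/measurable_funTS.
- by apply: erestrict_ge0 => z _; rewrite lee_fin ltW// gauss_density_gt0.
rewrite /product_measure1; apply: eq_integral => w _ /=.
rewrite /normal_prob integral_mkcond; apply: eq_integral => t _.
rewrite !patchE; congr (if _ then _ else _).
by apply/idP/idP; rewrite mem_xsection.
Qed.

Lemma product_normal_prob_dominates : (mu \x normal_prob 0 1)%E `<< m.
Proof.
exact: (density_null_dominates (P := (mu \x normal_prob 0 1)%E)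
  measurable_gauss_density product_normal_prob_density).
Qed.

Lemma dominates_product_normal_prob : m `<< (mu \x normal_prob 0 1)%E.
Proof.
apply: (null_dominates_density (P := (mu \x normal_prob 0 1)%E)
  measurable_gauss_density product_normal_prob_density).
exact: gauss_density_gt0.
Qed.

Lemma ge0_integral_product_normal_prob (f : X -> \bar R) (A : set X) :
  measurable A -> measurable_fun A f -> (forall z, 0 <= f z)%E ->
  (\int[mu \x normal_prob 0 1]_(z in A) f z =
   \int[m]_(z in A) (f z * (gauss_density z)%:E))%E.
Proof.
move=> mA mf f0; have mgd := measurable_gauss_density.
have mfA : measurable_fun [set: X] (f \_ A).
  exact/(measurable_restrictT _ _).1.
have fA0 z : (0 <= (f \_ A) z)%E by exact: erestrict_ge0.
rewrite integral_mkcond fubini_tonelli1// [RHS]integral_mkcond.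
have -> : (fun z => f z * (gauss_density z)%:E)%E \_ A =
    (fun z => (f \_ A) z * (gauss_density z)%:E)%E.
  by apply/funext => z; rewrite !patchE; case: ifP => // _; rewrite mul0e.
rewrite fubini_tonelli1//; last 2 first.
- by apply: emeasurable_funM => //; exact/measurable_EFinP.
- by move=> z; rewrite mule_ge0// lee_fin ltW// gauss_density_gt0.
apply: eq_integral => w _; rewrite /fubini_F.
rewrite (ge0_integral_density (mu := leb) (P := normal_prob 0 1)
  (p := normal_pdf 0 1))//.
- exact: measurable_normal_pdf.
- by move=> t; exact: normal_pdf_ge0.
- exact: (measurableT_comp mfA (pair1_measurable w)).
Qed.

End skew_product.

(** * Dissipativity of Gaussian skew products *)

Section tonelli.
Context d1 d2 (T1 : measurableType d1) (T2 : measurableType d2) (R : realType).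
Variables (m1 : {measure set T1 -> \bar R}).
Variable m2 : {sigma_finite_measure set T2 -> \bar R}.
Hypothesis m1sf : sigma_finite [set: T1] m1.
Variable f : T1 * T2 -> \bar R.
Hypotheses (mf : measurable_fun [set: T1 * T2] f) (f0 : forall z, (0 <= f z)%E).

(** Sigma-finiteness of [m1] is a hypothesis rather than part of its type; [m1'] bundles the two so
    that Tonelli's theorem applies. *)
Let sf_m1 := @isSFinite.Build _ _ _ m1 (sfinite_measure_sigma_finite m1sf).
Let sgf_m1 := @isSigmaFinite.Build _ _ _ m1 m1sf.
Let m1' : {sigma_finite_measure set T1 -> \bar R} :=
  HB.pack (Measure.sort m1) (Measure.class m1) sf_m1 sgf_m1.

Lemma sigma_finite_fubini_tonelli :
  (\int[m1]_x \int[m2]_y f (x, y) = \int[m2]_y \int[m1]_x f (x, y))%E.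
Proof. exact: (@fubini_tonelli _ _ _ _ _ m1' m2). Qed.

Lemma sigma_finite_measurable_fun_fubini :
  measurable_fun [set: T2] (fun y => \int[m1]_x f (x, y))%E.
Proof. exact: (@measurable_fun_fubini_tonelli_G _ _ _ _ _ m1'). Qed.

End tonelli.

Section dissipativity.
Context (R : realType) (d : measure_display) (G : topologicalGroupType d).
Context (lam : {measure set G -> \bar R}) (hl : left_haar lam).

Lemma regular_repM (g h : G) (f : L2 lam) :
  regular_rep hl g (regular_rep hl h f) = regular_rep hl (g * h)%g f.
Proof.
apply/LfuneqP => x /=; rewrite /left_translate; congr (f _).
by rewrite monoid.invgM monoid.mulgA.
Qed.

Lemma regular_rep1 (f : L2 lam) : regular_rep hl 1%g f = f.
Proof.
apply/LfuneqP => x /=; rewrite /left_translate.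
by rewrite monoid.invg1 monoid.mul1g.
Qed.

Context (d' : measure_display) (W : measurableType d') (mu : probability W R).
Variables (J : L2 lam -> {mfun W >-> R}) (pih : G -> W -> W).
Hypotheses (gaussJ : gaussian_construction mu J).
Hypotheses (gauss_pih : gaussian_action hl mu J pih).

Lemma measurable_pih g : measurable_fun [set: W] (pih g).
Proof. by have [[]] := gauss_pih g. Qed.

Lemma pih_preserving g A : measurable A -> mu (pih g @^-1` A) = mu A.
Proof. by have [[_ + _] _] := gauss_pih g; apply. Qed.

(** The defining relation at g^-1, applied to pi(g) xi and pulled back along the measure-preserving
    [pih g], is combined with the relation at [g]. *)
Lemma ae_gaussian_pihV g (xi : L2 lam) :
  {ae mu, forall w, J xi (pih g^-1%g (pih g w)) = J xi w}.
Proof.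
have [_ Jg] := gauss_pih g; have [_ Jg'] := gauss_pih g^-1%g.
have := ae_preserving (measurable_pih g) (@pih_preserving g)
  (Jg' (regular_rep hl g xi)).
rewrite regular_repM monoid.mulVg regular_rep1.
by apply: filterS2 (Jg xi) => w <- <-.
Qed.

(* pih g^-1 inverts pih g only up to null sets, and only as seen by measurable
   sets: this uses that the Gaussian variables generate the sigma-algebra. *)
Lemma ae_pihV g (A : set W) : measurable A ->
  {ae mu, forall w, A (pih g^-1%g (pih g w)) <-> A w}.
Proof.
move=> mA; have [B CB AB0] := gaussian_generate gaussJ mA.
have JB : {ae mu, forall w, B (pih g^-1%g (pih g w)) <-> B w}.
  apply: (ae_invariant_generated (S := pih g^-1%g \o pih g) _ CB).
  move=> _ [[xi V] /= mV <-].
  by apply: filterS (ae_gaussian_pihV g xi) => w /= ->.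
have mB : measurable B.
  move: B CB {AB0 JB}; apply: smallest_sub; first exact: sigma_algebra_measurable.
  move=> _ [[xi V] /= mV <-].
  by rewrite -[_ @^-1` _]setTI; exact: (measurable_funPT (J xi)).
have AB : {ae mu, forall w, A w <-> B w}.
  exists ((A `\` B) `|` (B `\` A)); split => //.
    by apply: measurableU; exact: measurableD.
  move=> w /= nAB; have [Aw|Aw] := pselect (A w); [left|right]; split => //.
    by move=> Bw; apply: nAB.
  by apply: contrapT => Bw; apply: nAB.
(* The equivalence of [A] and [B] is also needed at the image point, hence preservation of [mu] by
   the composite. *)
have mpp : measurable_fun [set: W] (pih g^-1%g \o pih g).
  by apply: measurableT_comp; exact: measurable_pih.
have ppmu C : measurable C -> mu ((pih g^-1%g \o pih g) @^-1` C) = mu C.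
  move=> mC; rewrite comp_preimage pih_preserving ?pih_preserving//.
  by rewrite -[_ @^-1` _]setTI; exact: (measurable_pih g^-1%g).
have := ae_preserving mpp ppmu AB; move: AB JB.
by apply: filterS3 => w /= -> -> ->.
Qed.

Lemma ae_gaussian_opp (xi eta : L2 lam) : (forall x, xi x + eta x = 0) ->
  {ae mu, forall w, J xi w + J eta w = 0}.
Proof.
move=> xe0; have -> : xi = (-1) *: eta + 0.
  apply/LfuneqP => x /=; rewrite addr0 scaleN1r.
  by apply/eqP; rewrite -addr_eq0 xe0.
(* The instance at [1 0 0] reads J 0 = J 0 + J 0, so J 0 vanishes almost everywhere. *)
have := gaussian_linear gaussJ 1 0 0; have := gaussian_linear gaussJ (-1) eta 0.
apply: filterS2 => w ->; rewrite scaler0 addr0 mul1r => J0; lra.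
Qed.

(** * Radon-Nikodym derivatives for a locally constant cocycle *)

Section cocycle.
Variable c : G -> L2 lam.
Hypothesis csc : @second_countable G.
Hypothesis lamsf : sigma_finite [set: G] lam.
Hypothesis c_locally_constant : forall g, \forall h \near g, c h = c g.
Hypothesis cV : forall g x, c g^-1%g x + regular_rep hl g^-1%g (c g) x = 0.

Notation X := (W * measurableTypeR R)%type.
Notation m := (mu \x @lebesgue_measure R)%E.

(** The value of [gauss_density] at beta_g(w,t), numerator of d(g^-1 nu)/dnu; [pih] is absent
    because the density depends on the real coordinate only. *)
Definition gauss_translate (z : G * X) : R :=
  normal_pdf 0 1 (z.2.2 + J (c z.1^-1%g) z.2.1).

Lemma gauss_translate_ge0 z : 0 <= gauss_translate z.
Proof. exact: normal_pdf_ge0. Qed.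

Lemma measurable_gauss_translate :
  measurable_fun [set: G * X] gauss_translate.
Proof.
apply: (measurable_locally_constant
  (f := fun g (x : X) => normal_pdf 0 1 (x.2 + J (c g^-1%g) x.1)) csc).
  move=> g; have cV' : \forall h \near g, c h^-1%g = c g^-1%g.
    exact: (@invg_continuous _ G g _ (c_locally_constant g^-1%g)).
  by near=> h; have -> : c h^-1%g = c g^-1%g by near: h.
move=> g; apply: (measurableT_comp (measurable_normal_pdf 0 1)).
apply: measurable_funD => //.
exact: (measurableT_comp (measurable_funPT (J (c g^-1%g)))).
Unshelve. all: by end_near. Qed.

(** The two real shifts add up to J(c(g^-1)) + J(pi(g^-1) c(g)), almost everywhere zero by [cV],
    while [pih g^-1] undoes [pih g] by [ae_pihV]. *)
Lemma ae_skew_productV g (A : set X) : measurable A ->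
  {ae m, forall z, A (skew_product J pih c g^-1%g
    (skew_map (pih g) (J (c g^-1%g)) z)) <-> A z}.
Proof.
move=> mA.
pose Z w := J (c g^-1%g) w + J (c g) (pih g w).
have Z0 : {ae mu, forall w, Z w = 0}.
  have [_ Jg] := gauss_pih g.
  have := Jg (regular_rep hl g^-1%g (c g)); rewrite regular_repM.
  rewrite monoid.mulgV regular_rep1.
  have := ae_gaussian_opp (cV g).
  by apply: filterS2 => w + Jw; rewrite /Z Jw.
have := ae_skew_id (p := pih g^-1%g \o pih g) (ae_pihV g) Z0 mA.
apply: filterS => z; rewrite /skew_map /skew_product/= /Z monoid.invgK addrA.
by [].
Qed.

Lemma skew_product_density g (A : set X) : measurable A ->
  (mu \x normal_prob 0 1)%E (skew_product J pih c g^-1%g @^-1` A) =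
  (\int[mu \x normal_prob 0 1]_(z in A)
     (gauss_translate (g, z) / gauss_density z)%:E)%E.
Proof.
move=> mA.
have mgd := @measurable_gauss_density _ W R.
have mgt : measurable_fun [set: X] (fun z => gauss_translate (g, z)).
  by apply: measurableT_comp; [exact: measurable_gauss_translate|exact: pair1_measurable].
have mS : measurable_fun [set: X] (skew_map (pih g) (J (c g^-1%g))).
  by apply: measurable_skew => //; exact: measurable_pih.
have mT : measurable_fun [set: X] (skew_product J pih c g^-1%g).
  by apply: (measurable_skew (Y := J (c g^-1^-1%g))) => //; exact: measurable_pih.
have mTA : measurable (skew_product J pih c g^-1%g @^-1` A).
  by rewrite -[_ @^-1` _]setTI; exact: mT.
rewrite ge0_integral_product_normal_prob//; last 2 first.
- apply/measurable_EFinP/measurable_funTS; apply: measurable_funM => //.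
  exact: measurable_gauss_densityV.
- by move=> z; rewrite lee_fin; exact: (divr_ge0 (gauss_translate_ge0 _) (gauss_density_ge0 _)).
under eq_integral => z _.
  rewrite -EFinM divfK; last by rewrite gt_eqF// gauss_density_gt0.
  over.
rewrite /=.
rewrite product_normal_prob_density// integral_mkcond epatch_indic.
(* Substituting beta_g turns the density into [gauss_translate] and, by [ae_skew_productV], the
   indicator of the preimage of [A] into that of [A]. *)
rewrite -(ge0_integral_skew (measurable_pih g) (measurable_funPT (J (c g^-1%g))) (@pih_preserving g)) /=.
- rewrite [RHS]integral_mkcond epatch_indic.
  apply: ge0_ae_eq_integral => //.
  + apply: emeasurable_funM.
      by apply/measurable_EFinP; exact: (measurableT_comp mgd mS).
    apply/measurable_EFinP.
    exact: (measurableT_comp (measurable_indic mTA) mS).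
  + by apply: emeasurable_funM; exact/measurable_EFinP.
  + by move=> z _; apply: mule_ge0; rewrite lee_fin//; exact: gauss_density_ge0.
  + by move=> z _; apply: mule_ge0; rewrite lee_fin//; exact: gauss_translate_ge0.
  + apply: filterS (ae_skew_productV g mA) => z Az _; congr (_ * _)%E.
    rewrite !indicE; congr ((nat_of_bool _)%:R%:E).
    by apply/idP/idP => /set_mem/= ?; apply/mem_set/Az.
- apply: emeasurable_funM; first exact/measurable_EFinP.
  by apply/measurable_EFinP; exact: measurable_indic.
- by move=> z; apply: mule_ge0; rewrite lee_fin//; exact: gauss_density_ge0.
Qed.

Lemma integral_gauss_translate_le1 g :
  (\int[mu \x normal_prob 0 1]_z (gauss_translate (g, z))%:E <= 1)%E.
Proof.
rewrite -(@probability_setT _ _ _ (mu \x normal_prob 0 1)%E).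
rewrite -[leRHS]mul1e -integral_cst//.
apply: ge0_le_integral => //.
- by move=> z _; rewrite lee_fin gauss_translate_ge0.
- apply/measurable_EFinP; apply: measurableT_comp.
    exact: measurable_gauss_translate.
  exact: pair1_measurable.
- move=> z _; rewrite lee_fin (le_trans (normal_pdf_ub _ _ _))//.
  by rewrite (le_trans (normal_peak_le _))// invr1.
Qed.

(** Integrating over [w] first, the shift is distributed as N(0,t^2) with [t] the norm of c(g^-1),
    so [normal_smoothing_bound] applies uniformly in the real coordinate. *)
Lemma integral_gauss_translate_le g (s : R) : 0 < s -> s <= L2norm (c g^-1%g) ->
  (\int[mu \x normal_prob 0 1]_z (gauss_translate (g, z))%:E <= s^-1%:E)%E.
Proof.
move=> s0 sc; set t := L2norm _ in sc; have t0 := lt_le_trans s0 sc.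
have mgt : measurable_fun [set: X] (fun z => (gauss_translate (g, z))%:E).
  apply/measurable_EFinP; apply: measurableT_comp.
    exact: measurable_gauss_translate.
  exact: pair1_measurable.
rewrite fubini_tonelli2//; last first.
  by move=> z; rewrite lee_fin gauss_translate_ge0.
rewrite -[leRHS]mule1 -(@probability_setT _ _ _ (@normal_prob R 0 1)).
rewrite -integral_cst//; apply: ge0_le_integral => //.
- by move=> x _; apply: integral_ge0 => w _; rewrite lee_fin gauss_translate_ge0.
- apply: measurable_fun_fubini_tonelli_G => // z.
  by rewrite lee_fin gauss_translate_ge0.
move=> x _; rewrite /fubini_G/= /gauss_translate/=.
have mx : measurable_fun [set: R] (fun y : R => (normal_pdf 0 1 (x + y))%:E).
  apply/measurable_EFinP; apply: measurableT_comp.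
    exact: measurable_normal_pdf.
  exact: measurable_funD.
apply: (@le_trans _ _ t^-1%:E); last by rewrite lee_fin lef_pV2.
apply: le_trans (normal_smoothing_bound x t0).
pose Jg : W -> measurableTypeR R := J (c g^-1%g).
have mJ : measurable_fun [set: W] Jg by exact: (measurable_funPT (J (c g^-1%g))).
rewrite le_eqVlt; apply/orP; left; apply/eqP.
transitivity (\int[pushforward mu Jg]_y (normal_pdf 0 1 (x + y))%:E)%E.
  rewrite ge0_integral_pushforward// ?preimage_setT// => y _.
  by rewrite lee_fin normal_pdf_ge0.
apply: eq_measure_integral => A mA _.
rewrite [LHS](gaussian_law gaussJ)//.
by rewrite /centered_gaussian gt_eqF.
Qed.

(** [q] is an integrable majorant of the nu-averages of [gauss_translate]; the first alternative of
    [qc] covers elements where the cocycle may vanish. *)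
Variable q : G -> R.
Hypotheses (mq : measurable_fun [set: G] q) (q0 : forall g, 0 < q g).
Hypothesis qint : (\int[lam]_g (q g)%:E < +oo)%E.
Hypothesis qc : forall g, 1 <= q g \/ (q g)^-1 <= L2norm (c g^-1%g).

(** By Tonelli and [q], the integral [I] of the numerators over [G] is nu-integrable, so finite
    nu-a.e. and then m-a.e.; the denominator is positive and does not depend on [g]. *)
Lemma skew_product_dissipative :
  dissipative lam (mu \x lebesgue_measure)%E (skew_product J pih c).
Proof.
have mgd := @measurable_gauss_density _ W R.
have mgt := measurable_gauss_translate.
have mEgt : measurable_fun [set: G * X] (fun z => (gauss_translate z)%:E).
  exact/measurable_EFinP.
pose nu : probability X R := (mu \x normal_prob 0 1)%E.
have mnu : m `<< nu by exact: dominates_product_normal_prob.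
exists nu; split => //; first exact: product_normal_prob_dominates.
exists (fun z => (gauss_translate z / gauss_density z.2)%:E); split.
- apply/measurable_EFinP; apply: measurable_funM => //.
  exact: (measurableT_comp (@measurable_gauss_densityV _ W R) measurable_snd).
- by move=> z; rewrite lee_fin; exact: (divr_ge0 (gauss_translate_ge0 _) (gauss_density_ge0 _)).
- exact: skew_product_density.
pose I (z : X) := (\int[lam]_g (gauss_translate (g, z))%:E)%E.
have gt0 z : (0 <= (gauss_translate z)%:E)%E.
  by rewrite lee_fin gauss_translate_ge0.
have mI : measurable_fun [set: X] I.
  exact: (sigma_finite_measurable_fun_fubini lamsf mEgt gt0).
have I0 z : (0 <= I z)%E by exact: integral_ge0.
have intI : nu.-integrable [set: X] I.
  apply/integrableP; split => //.
  under eq_integral do rewrite gee0_abs//.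
  rewrite /I -(sigma_finite_fubini_tonelli nu lamsf mEgt gt0).
  apply: le_lt_trans qint; apply: ge0_le_integral => //.
  - by move=> g _; exact: integral_ge0.
  - exact: (measurable_fun_fubini_tonelli_F (m2 := nu) _ mEgt gt0).
  - exact/measurable_EFinP.
  - move=> g _; have [q1|cq] := qc g.
      by rewrite (le_trans (integral_gauss_translate_le1 g)) ?lee_fin.
    rewrite -[q g]invrK; apply: integral_gauss_translate_le => //.
    by rewrite invr_gt0.
have [N [mN N0 IN]] := integrable_ae measurableT intI.
exists N; split => //.
  by move: mnu => /null_content_dominatesP; apply.
move=> z nz; apply: IN => /= /(_ Logic.I) Ifin; apply: nz => /=.
under eq_integral do rewrite EFinM.
rewrite ge0_integralZr//; last 2 first.
- exact: (measurableT_comp mEgt (pair2_measurable z)).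
- by rewrite lee_fin invr_ge0 ltW// gauss_density_gt0.
rewrite lte_mul_pinfty//; first exact: I0.
by rewrite ltry.
Qed.

End cocycle.
End dissipativity.

(** * Coboundaries along a chain of compact open subgroups *)

Section topological_group.
Context (d : measure_display) (G : topologicalGroupType d).

Lemma mulg_continuousl (g : G) : continuous (fun x : G => (g * x)%g).
Proof.
move=> x; apply: (@cvg_comp _ _ _ (fun x : G => (g, x))
  (fun z : G * G => (z.1 * z.2)%g) _ (nbhs (g, x)) _).
  by apply: cvg_pair; [exact: cvg_cst|exact: cvg_id].
exact: (mulg_continuous (g, x)).
Qed.

Lemma open_measurable_group (U : set G) : open U -> measurable U.
Proof. by move=> oU; rewrite measurable_borel; exact: sub_sigma_algebra. Qed.

Lemma locally_constant_open (T : Type) (f : G -> T) :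
  (forall x, \forall y \near x, f y = f x) -> forall A, open (f @^-1` A).
Proof.
move=> flc A; rewrite openE => x /= Afx; rewrite /interior/=.
by apply: filterS (flc x) => y /= ->.
Qed.

Lemma locally_constant_measurable d' (T : measurableType d') (f : G -> T) :
  (forall x, \forall y \near x, f y = f x) -> measurable_fun [set: G] f.
Proof.
move=> flc _ Y mY; rewrite setTI; apply: open_measurable_group.
exact: locally_constant_open.
Qed.

Lemma near_coset (K : set G) (x : G) : open K -> K 1%g ->
  \forall y \near x, K (x^-1 * y)%g.
Proof.
move=> oK K1; have nK : nbhs (x^-1 * x)%g K.
  by apply: open_nbhs_nbhs; split; rewrite // monoid.mulVg.
exact: (mulg_continuousl nK).
Qed.

(** If [K] were null, so would be its left cosets; countably many basic open sets, each inside a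
    coset, cover [G], which would make [lam] zero. *)
Lemma haar_open_subgroup_gt0 (R : realType) (lam : {measure set G -> \bar R})
  (K : set G) : left_haar lam -> @second_countable G -> open K -> is_subgroup K ->
  (0 < lam K)%E.
Proof.
move=> hl [B cB [Bo Bb]] oK [K1 KM KV].
rewrite lt0e measure_ge0 andbT; apply/negP => /eqP K0.
have /negP := left_haar_neq0 hl; apply; apply/eqP.
have [p pinj] := countable_injP _ cB.
(* [F n] is the basic set numbered [n] by [p] if it lies in a coset of [K], and empty otherwise. *)
pose F n : set G := \bigcup_(b in [set b | B b /\ p b = n /\
  exists g, b `<=` [set y | K (g^-1 * y)%g]]) b.
have cosetE g : [set y | K (g^-1 * y)%g] = [set (g * x)%g | x in K].
  apply/seteqP; split => [y Ky|_ [x Kx <-]] /=.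
    by exists (g^-1 * y)%g; rewrite ?monoid.mulVKg.
  by rewrite monoid.mulKg.
have F0 n : lam.-negligible (F n).
  have [[b [Bb' [pb [g bg]]]]|nb] := pselect (exists b, B b /\ p b = n /\
      exists g, b `<=` [set y | K (g^-1 * y)%g]).
    apply: (@negligibleS _ _ _ _ [set y | K (g^-1 * y)%g]).
      move=> y [b' [Bb'' [pb' _]] b'y]; apply: bg.
      by rewrite (pinj b b') ?inE// pb pb'.
    have mgK : measurable [set y | K (g^-1 * y)%g].
      rewrite -[X in measurable X]setTI.
      by apply: (measurable_mulg (g^-1)%g) => //; exact: open_measurable_group.
    apply/(negligibleP _ mgK); rewrite cosetE.
    exact: etrans (left_haar_invariant hl g (open_measurable_group oK)) K0.
  rewrite (_ : F n = set0); first exact: negligible_set0.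
  by apply/seteqP; split => // y [b bP _]; apply: nb; exists b.
apply/negligibleP => //; apply: negligibleS (negligible_bigcup F0).
move=> x _; have [b [Bb' bx] bK] := Bb x _ (near_coset x oK K1).
by exists (p b) => //; exists b => //; split => //; split => //; exists x.
Qed.

End topological_group.

(** * The level function of the chain and its ultrametric behaviour *)

Section level.
Context (d : measure_display) (G : topologicalGroupType d) (K : nat -> set G).
Hypothesis Ksub : forall n, is_subgroup (K n).
Hypothesis Kincr : forall n, K n `<=` K n.+1.
Hypothesis Kcover : \bigcup_n K n = [set: G].

Let ex_level x : exists n, `[< K n x >].
Proof.
have [n _ Kx] : (\bigcup_n K n) x by rewrite Kcover.
by exists n; exact/asboolP.
Qed.

Definition level (x : G) : nat := ex_minn (ex_level x).

Lemma subgroup_chain_le m n : (m <= n)%N -> K m `<=` K n.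
Proof.
elim: n => [|n IHn]; first by rewrite leqn0 => /eqP ->.
rewrite leq_eqVlt => /predU1P[->//|]; rewrite ltnS => /IHn.
by move=> Kmn x /Kmn; exact: Kincr.
Qed.

Lemma levelP n x : K n x <-> (level x <= n)%N.
Proof.
rewrite /level; case: ex_minnP => l /asboolP Kl lmin; split.
  by move=> Kn; apply: lmin; exact/asboolP.
by move=> ln; exact: subgroup_chain_le Kl.
Qed.

Lemma levelV x : level x^-1%g = level x.
Proof.
have le y : (level y^-1%g <= level y)%N.
  by have [_ _ KV] := Ksub (level y); apply/levelP/KV/levelP.
by apply/eqP; rewrite eqn_leq le -{1}[x]monoid.invgK le.
Qed.

Lemma subgroup_mull n x y : (level x <= n)%N -> K n (x * y)%g <-> K n y.
Proof.
have [_ KM KV] := Ksub n; move=> /levelP Kx; split; last exact: KM.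
by move=> /(KM _ _ (KV _ Kx)); rewrite monoid.mulKg.
Qed.

(** Any [K n] containing x y contains [y] as soon as it contains [x]; a level of x y below that of
    [x] would force [y] into [K (level x)]. *)
Lemma levelM_lt x y : (level x < level y)%N -> level (x * y)%g = level y.
Proof.
move=> xy; apply/eqP; rewrite eqn_leq; apply/andP; split.
  by apply/levelP/subgroup_mull; [exact: ltnW|exact/levelP].
have [xm|mx] := leqP (level x) (level (x * y)%g).
  by apply/levelP/(subgroup_mull _ xm)/levelP.
have : K (level x) (x * y)%g by apply/levelP/ltnW.
by move/(subgroup_mull _ (leqnn _))/levelP; rewrite leqNgt xy.
Qed.

Lemma levelM0 x y : level x = 0%N -> level (x * y)%g = level y.
Proof.
move=> x0; have xn n : K n (x * y)%g <-> K n y.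
  by apply: subgroup_mull; rewrite x0.
by apply/eqP; rewrite eqn_leq; apply/andP; split; apply/levelP/xn/levelP.
Qed.

Hypothesis Kopen : forall n, open (K n).

Lemma near_level0 (x : G) : \forall y \near x, level (x^-1 * y)%g = 0%N.
Proof.
have [K1 _ _] := Ksub 0.
apply: filterS (near_coset x (Kopen 0) K1) => y /levelP.
by rewrite leqn0 => /eqP.
Qed.

(** Near [x], [y] lies in x K_0; inversion preserves levels and moves the K_0 factor to the left,
    where [levelM0] removes it. *)
Lemma level_locally_constant (x : G) : \forall y \near x, level y = level x.
Proof.
apply: filterS (near_level0 x) => y xy.
rewrite -[LHS]levelV -[RHS]levelV.
have -> : (y^-1 = (x^-1 * y)^-1 * x^-1)%g.
  by rewrite monoid.invgM monoid.invgK monoid.mulgK.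
by rewrite levelM0// levelV.
Qed.

End level.

Lemma Lnorm2E (d : measure_display) (T : measurableType d) (R : realType)
    (mu : {measure set T -> \bar R}) (f : T -> R) :
  ('N[mu]_2%:E[EFin \o f] = (\int[mu]_x (f x ^+ 2)%:E) `^ 2^-1)%E.
Proof.
rewrite unlock /Lnorm; congr (_ `^ _)%E; apply: eq_integral => x _ /=.
by rewrite -[2]/(2%:R) powR_mulrn// real_normK// num_real.
Qed.

(** * The cocycle attached to a nondecreasing sequence *)

Section level_cocycle.
Context (R : realType) (d : measure_display) (G : topologicalGroupType d).
Context (lam : {measure set G -> \bar R}) (hl : left_haar lam).
Variable K : nat -> set G.
Hypothesis Ksub : forall n, is_subgroup (K n).
Hypothesis Kcompact : forall n, compact (K n).
Hypothesis Kopen : forall n, open (K n).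
Hypothesis Kincr : forall n, K n `<=` K n.+1.
Hypothesis Kcover : \bigcup_n K n = [set: G].

Let mK n : measurable (K n).
Proof. exact: open_measurable_group. Qed.

Let Kfin n : (lam (K n) < +oo)%E.
Proof. exact: (left_haar_compact hl). Qed.

Notation lev := (level Kcover).

Definition Ksize n : R := fine (lam (K n)).

Lemma KsizeE n : (Ksize n)%:E = lam (K n).
Proof. by rewrite /Ksize fineK// ge0_fin_numE. Qed.

Lemma Ksize_ge0 n : 0 <= Ksize n.
Proof. by rewrite fine_ge0. Qed.

Lemma Ksize_le m n : (m <= n)%N -> Ksize m <= Ksize n.
Proof.
move=> mn; rewrite -lee_fin !KsizeE le_measure ?inE//.
exact: subgroup_chain_le.
Qed.

Lemma sigma_finite_haar : sigma_finite [set: G] lam.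
Proof. by exists K; rewrite ?Kcover. Qed.

Section cocycle_of_sequence.
Variable b : nat -> R.
Hypotheses (b0 : b 0%N = 0) (b_nd : forall m n, (m <= n)%N -> b m <= b n).

Let b_ge0 n : 0 <= b n. Proof. by rewrite -b0 b_nd. Qed.

(* The coboundary of the function b \o lev, which need not be in L^2. *)
Definition cob (g x : G) : R := b (lev (g^-1 * x)%g) - b (lev x).

Lemma cob_locally_constant g x : \forall y \near x, cob g y = cob g x.
Proof.
have glc : \forall y \near x, lev (g^-1 * y)%g = lev (g^-1 * x)%g.
  exact: (mulg_continuousl (level_locally_constant Ksub Kincr Kcover Kopen _)).
near=> y; rewrite /cob; congr (b _ - b _); near: y => //.
exact: (level_locally_constant Ksub Kincr Kcover Kopen).
Unshelve. all: by end_near. Qed.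

Lemma cob_supp g x : ~ K (lev g) x -> cob g x = 0.
Proof.
move=> gx; rewrite /cob levelM_lt ?subrr// levelV//.
by rewrite ltnNge; apply/negP => /(levelP Kincr).
Qed.

(** On the support both x and g^-1 x lie in [K (lev g)], where the two terms of [cob] lie between 0
    and [b (lev g)]. *)
Lemma norm_cob_le g x : `|cob g x| <= b (lev g).
Proof.
have [gx|gx] := pselect (K (lev g) x); last by rewrite cob_supp// normr0.
have xg : (lev x <= lev g)%N by apply/levelP.
have gxg : (lev (g^-1 * x)%g <= lev g)%N.
  have gg : (lev g^-1%g <= lev g)%N by rewrite levelV.
  by apply/(levelP Kincr)/(subgroup_mull Ksub Kincr x gg).
have := b_nd xg; have := b_nd gxg.
have := b_ge0 (lev x); have := b_ge0 (lev (g^-1 * x)%g).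
by rewrite /cob ler_norml => *; apply/andP; split; lra.
Qed.

Let measurable_cob g : measurable_fun [set: G] (cob g).
Proof. exact: locally_constant_measurable (cob_locally_constant g). Qed.

Lemma cob_Lfun g : cob g \in Lfun lam 2%:E.
Proof.
apply/andP; split; rewrite inE//= /finite_norm Lnorm2E poweR_lty//.
apply: (@le_lt_trans _ _ (\int[lam]_(x in K (lev g)) cst (b (lev g) ^+ 2)%:E x)%E).
  rewrite [leRHS]integral_mkcond; apply: ge0_le_integral => //.
  - by move=> x _; rewrite lee_fin sqr_ge0.
  - apply/measurable_EFinP; exact: measurable_funX.
  - by apply/(measurable_restrictT _ _).1 => //; exact: measurable_cst.
  move=> x _; rewrite patchE; case: ifPn => [_|/negP xK].
    by rewrite lee_fin -(real_normK (num_real _)) ler_sqr ?nnegrE ?norm_cob_le.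
  by rewrite cob_supp ?expr0n// => Kx; apply: xK; exact/mem_set.
by rewrite integral_cst// -KsizeE -EFinM ltry.
Qed.

Definition cocycle_of (g : G) : L2 lam := Lfun_Sub _ (cob_Lfun g).

Lemma cocycle_ofE g x : cocycle_of g x = b (lev (g^-1 * x)%g) - b (lev x).
Proof. by []. Qed.

Lemma cocycle_of_locally_constant g : \forall h \near g, cocycle_of h = cocycle_of g.
Proof.
apply: filterS (near_level0 Ksub Kincr Kcover Kopen g) => h gh.
apply/LfuneqP => x; rewrite !cocycle_ofE; congr (b _ - _).
have -> : (h^-1 * x = (g^-1 * h)^-1 * (g^-1 * x))%g.
  by rewrite monoid.invgM monoid.invgK monoid.mulgA monoid.mulgK.
by rewrite levelM0// levelV.
Qed.

Lemma L2norm0 : L2norm (0 : L2 lam) = 0.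
Proof. by rewrite /L2norm /= (Lnorm0 lam). Qed.

Lemma cocycle_of_cocycle : is_cocycle hl cocycle_of.
Proof.
split.
  move=> g; apply: cvg_near_cst; near=> h.
  have -> : cocycle_of h = cocycle_of g.
    by near: h; exact: cocycle_of_locally_constant.
  by rewrite subrr L2norm0.
move=> g h; apply: aeW => x /=.
rewrite fctE /left_translate /cob monoid.invgM monoid.mulgA; ring.
Unshelve. all: by end_near. Qed.

Lemma cocycle_ofV g x :
  cocycle_of g^-1%g x + regular_rep hl g^-1%g (cocycle_of g) x = 0.
Proof.
rewrite /= /left_translate /cob !monoid.invgK monoid.mulKg; ring.
Qed.

(** On [K n] the point g^-1 x has level n+1 and [x] has level at most n, so the jump of [b] bounds
    [cob] below; [K n] has measure at least [Ksize 0]. *)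
Lemma L2norm_cocycle_of_ge g n : lev g = n.+1 ->
  (b n.+1 - b n) * Num.sqrt (Ksize 0) <= L2norm (cocycle_of g).
Proof.
move=> gn; rewrite -lee_fin /L2norm finite_norm_fine Lnorm2E.
have bn : 0 <= b n.+1 - b n by rewrite subr_ge0 b_nd.
have -> : ((b n.+1 - b n) * Num.sqrt (Ksize 0))%:E =
    (((b n.+1 - b n) ^+ 2 * Ksize 0)%:E `^ 2^-1)%E.
  rewrite poweR_EFin powR12_sqrt; last by rewrite mulr_ge0 ?sqr_ge0 ?Ksize_ge0.
  by rewrite sqrtrM ?sqr_ge0// sqrtr_sqr ger0_norm.
apply: gt0_ler_poweR; rewrite ?in_itv/= ?leey ?andbT ?lee_fin ?invr_ge0//.
- by rewrite mulr_ge0 ?sqr_ge0 ?Ksize_ge0.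
- by apply: integral_ge0 => x _; rewrite lee_fin sqr_ge0.
apply: (@le_trans _ _ (\int[lam]_(x in K n) cst ((b n.+1 - b n) ^+ 2)%:E x)%E).
  by rewrite integral_cst// -KsizeE -EFinM lee_fin ler_wpM2l ?sqr_ge0 ?Ksize_le.
apply: (@le_trans _ _ (\int[lam]_(x in K n) (cob g x ^+ 2)%:E)%E).
  apply: ge0_le_integral => //.
  - by move=> x _; rewrite lee_fin sqr_ge0.
  - by apply/measurable_EFinP/measurable_funTS; exact: measurable_funX.
  move=> x Kx; rewrite lee_fin.
  have xn : (lev x <= n)%N by apply/levelP.
  have -> : cob g x = b n.+1 - b (lev x).
    (* Passing to the inverse x^-1 g puts the factor of smaller level on the left, as [levelM_lt]
       requires. *)
    rewrite /cob -[(g^-1 * x)%g]monoid.invgK levelV// monoid.invgM monoid.invgK.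
    by rewrite levelM_lt ?gn ?levelV.
  have := b_nd xn; move=> bx; rewrite ler_sqr ?nnegrE//; lra.
apply: ge0_subset_integral => //.
- by apply/measurable_EFinP; exact: measurable_funX.
- by move=> x _; rewrite lee_fin sqr_ge0.
Qed.

End cocycle_of_sequence.

(** * Choice of the sequence, growth exponent and integrable weight *)

Hypothesis csc : @second_countable G.

Let Ksize0_gt0 : 0 < Ksize 0.
Proof. by rewrite -lte_fin KsizeE (haar_open_subgroup_gt0 hl csc). Qed.

(** The exponent beats every fixed power of lam(K_n), the factor 2 makes lam(K_n)/r_n summable, and
    the added 1 keeps the base at least 2. *)
Definition rate n : R := (2 * (1 + Ksize n)) ^+ n.

Let base_ge2 n : 2 <= 2 * (1 + Ksize n).
Proof. by have := Ksize_ge0 n; lra. Qed.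

Lemma rate_ge1 n : 1 <= rate n.
Proof. by apply: exprn_ege1; have := base_ge2 n; lra. Qed.

Let rate_gt0 n : 0 < rate n.
Proof. exact: lt_le_trans (rate_ge1 n). Qed.

Lemma rate_ge_expn n : 2 ^+ n <= rate n.
Proof. by apply: lerXn2r; rewrite ?nnegrE//; have := base_ge2 n; lra. Qed.

Lemma rate_ge_nat n : n%:R <= rate n.
Proof.
by apply: le_trans (rate_ge_expn n); rewrite -natrX ler_nat ltnW// ltn_expl.
Qed.

Lemma rate_ge_Ksize k m : (k <= m)%N -> Ksize m ^+ k <= rate m.
Proof.
have m0 := Ksize_ge0 m; have m2 := base_ge2 m.
move=> km; apply: (@le_trans _ _ ((2 * (1 + Ksize m)) ^+ k)).
  by apply: lerXn2r; rewrite ?nnegrE//; lra.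
by apply: ler_weXn2l => //; lra.
Qed.

Lemma Ksize_le_rate n : Ksize n * 2 ^+ n <= (1 + Ksize 0) * rate n.
Proof.
(* At n = 0 the rate is 1 whatever the size of K_0, whence the constant [1 + Ksize 0]. *)
have L0 := Ksize_ge0 0; case: n => [|n]; first by rewrite /rate !expr0; lra.
have Ln := Ksize_ge0 n.+1; rewrite /rate exprMn.
have : Ksize n.+1 <= (1 + Ksize n.+1) ^+ n.+1.
  by rewrite exprS (@le_trans _ _ (1 + Ksize n.+1))// ?ler_peMr ?exprn_ege1//; lra.
set x := Ksize n.+1; set y := (1 + x) ^+ _ => xy.
rewrite mulrC mulrCA ler_pM2l ?exprn_gt0// (le_trans xy)// ler_peMl//.
  exact: le_trans Ln xy.
by lra.
Qed.

(** The increment into level n+1 is r_(n+1) divided by the square root that appears in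
    [L2norm_cocycle_of_ge], so the norm there is at least r_(n+1). *)
Definition height n : R := \sum_(0 <= i < n) rate i.+1 / Num.sqrt (Ksize 0).

Let height0 : height 0 = 0. Proof. by rewrite /height big_geq. Qed.

Let heightS n : height n.+1 = height n + rate n.+1 / Num.sqrt (Ksize 0).
Proof. by rewrite /height big_nat_recr. Qed.

Let height_nd m n : (m <= n)%N -> height m <= height n.
Proof.
have [+ _] := nondecreasing_seqP height; apply => {m}n.
by rewrite heightS lerDl divr_ge0 ?sqrtr_ge0// ltW.
Qed.

Let c := cocycle_of height0 height_nd.

Lemma L2norm_level_cocycle_ge g : (0 < lev g)%N -> rate (lev g) <= L2norm (c g).
Proof.
case lg : (lev g) => [//|n] _.
apply: le_trans (L2norm_cocycle_of_ge height0 height_nd lg).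
by rewrite heightS addrC addKr divfK// gt_eqF// sqrtr_gt0.
Qed.

Lemma level_cocycle0 g : lev g = 0%N -> c g = 0.
Proof.
move=> g0; apply/LfuneqP => x; rewrite cocycle_ofE levelM0 ?levelV//.
by rewrite subrr.
Qed.

(** [m] is the largest index with [rate m <= s], which exists because [rate n] is at least n; an
    element of positive level in the sublevel set has rate at most [s] at its own level. *)
Lemma L2norm_level_cocycle_sublevel (k : nat) (s : R) : rate k <= s ->
  exists m, [/\ (k <= m)%N, rate m <= s & [set g | L2norm (c g) <= s] `<=` K m].
Proof.
move=> ks; have ex : exists n, rate n <= s by exists k.
have bd n : rate n <= s -> (n <= (Num.truncn s).+1)%N.
  move=> /(le_trans (rate_ge_nat n)) ns; apply: ltnW.
  by rewrite -(ltr_nat R) (le_lt_trans ns) ?truncnS_gt.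
case: (ex_maxnP ex bd) => m ms mmax; exists m; split => //; first exact: mmax.
move=> g /= gs; apply/(levelP Kincr Kcover).
have [->//|g0] := posnP (lev g).
by apply: mmax; exact: le_trans (L2norm_level_cocycle_ge g0) gs.
Qed.

Lemma level_cocycle_growth : growth_exponent c = 0%E.
Proof.
apply: limf_esup_eq0 => e e0.
(* With 1/k <= e, the bound lam(A)^k <= s gives the upper estimate. *)
pose k := (Num.truncn e^-1).+1.
have ek : 1 <= e * k%:R by rewrite mulrC -ler_pdivrMr// mul1r ltW// truncnS_gt.
near=> s.
have ks : rate k <= s by near: s; apply: nbhs_pinfty_ge; exact: num_real.
have s1 : 1 < s by near: s; apply: nbhs_pinfty_gt; exact: num_real.
(* For the lower estimate: lam(A) >= lam(K_0), whose logarithm may be negative but is then at least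
   -e ln s. *)
have es : expR (- ln (Ksize 0) / e) <= s by near: s; apply: nbhs_pinfty_ge; exact: num_real.
have s0 : 0 < s by lra.
have lns : 0 < ln s by rewrite ln_gt0.
pose A := [set g | L2norm (c g) <= s].
have mA : measurable A.
  apply: open_measurable_group.
  apply: (locally_constant_open (f := fun g => L2norm (c g)) _ [set x | x <= s]).
  move=> g; near=> h; congr (L2norm _); near: h.
  exact: cocycle_of_locally_constant.
have [m [km ms Am]] := L2norm_level_cocycle_sublevel ks.
have KA : K 0 `<=` A.
  move=> g /(levelP Kincr Kcover); rewrite leqn0 => /eqP g0.
  by rewrite /A/= level_cocycle0// L2norm0 ltW.
have lamA : (lam A <= (Ksize m)%:E)%E by rewrite KsizeE le_measure ?inE.
have lamA' : ((Ksize 0)%:E <= lam A)%E by rewrite KsizeE le_measure ?inE.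
pose a := fine (lam A).
have aE : lam A = a%:E.
  by rewrite /a fineK// ge0_fin_numE// (le_lt_trans lamA) ?ltry.
rewrite aE !lee_fin in lamA lamA'.
have a0 : 0 < a by exact: lt_le_trans lamA'.
rewrite /= -/A aE lne_EFin// -EFinM !lee_fin.
rewrite ler_pdivlMr// ler_pdivrMr//; apply/andP; split.
  have : ln (Ksize 0) <= ln a by rewrite ler_ln.
  have : - ln (Ksize 0) / e <= ln s by rewrite -ler_expR lnK.
  by rewrite ler_pdivrMr// mulrC mulNr; lra.
have : ln (a ^+ k) <= ln s.
  rewrite ler_ln ?posrE ?exprn_gt0//.
  apply: le_trans ms; apply: le_trans (rate_ge_Ksize km).
  by apply: lerXn2r => //; rewrite nnegrE ?Ksize_ge0// ltW.
rewrite lnXn// -mulr_natr => ak.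
rewrite -(@ler_pM2r _ k%:R) ?ltr0n// (le_trans ak)//.
by rewrite mulrAC ler_peMl// ltW.
Unshelve. all: by end_near. Qed.

Definition weight g : R := (rate (lev g))^-1.

Lemma measurable_weight : measurable_fun [set: G] weight.
Proof.
apply: locally_constant_measurable => g; near=> h; rewrite /weight.
congr (rate _)^-1; near: h.
exact: (level_locally_constant Ksub Kincr Kcover Kopen).
Unshelve. all: by end_near. Qed.

Lemma weight_gt0 g : 0 < weight g.
Proof. by rewrite invr_gt0. Qed.

Lemma weight_integral_lty : (\int[lam]_g (weight g)%:E < +oo)%E.
Proof.
pose f n g : \bar R := ((rate n)^-1%:E * (\1_(K n) g)%:E)%E.
have f0 n g : (0 <= f n g)%E by rewrite mule_ge0// lee_fin// invr_ge0 ltW.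
have mf n : measurable_fun [set: G] (f n).
  by apply: emeasurable_funM => //; apply/measurable_EFinP; exact: measurable_indic.
apply: (@le_lt_trans _ _ (\int[lam]_g \sum_(n <oo) f n g)%E).
  apply: ge0_le_integral => //.
  - by move=> g _; rewrite lee_fin ltW ?weight_gt0.
  - by apply/measurable_EFinP; exact: measurable_weight.
  - by apply: ge0_emeasurable_sum => // n x _ _.
  (* The term of index [lev g] alone already equals [weight g]. *)
  move=> g _; apply: le_trans (nneseries_lim_ge (lev g).+1 _) => //.
  rewrite big_nat_recr//= (le_trans _ (leeDr _ _))//; last exact: sume_ge0.
  by rewrite /f indicE mem_set ?mule1//; apply/levelP.
rewrite integral_nneseries//.
(* Geometric domination from [Ksize_le_rate]; the extra 2 compensates for the exponent n+1. *)
apply: (@le_lt_trans _ _ (\sum_(n <oo) ((2 * (1 + Ksize 0)) / (2 ^ n.+1)%:R)%:E)%E).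
  apply: lee_nneseries => n _; first by move=> _; exact: integral_ge0.
  rewrite ge0_integralZl//; last by rewrite lee_fin invr_ge0 ltW.
    rewrite integral_indic// setIT -KsizeE -EFinM lee_fin.
    rewrite ler_pdivlMr ?ltr0n ?expn_gt0// -mulrA ler_pdivrMl// natrX exprS.
    by have := Ksize_le_rate n; lra.
  by apply/measurable_EFinP; exact: measurable_indic.
apply: (@le_lt_trans _ _ (2 * (1 + Ksize 0))%:E); last by rewrite ltry.
by apply: epsilon_trick0; rewrite mulr_ge0// addr_ge0 ?Ksize_ge0.
Qed.

Lemma level_cocycle_exists : exists c : G -> L2 lam,
    [/\ is_cocycle hl c,
        growth_exponent c = 0%E
      & forall (d' : measure_display) (W : measurableType d')
          (mu : probability W R) (J : L2 lam -> {mfun W >-> R})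
          (pih : G -> W -> W),
          gaussian_construction mu J -> gaussian_action hl mu J pih ->
          dissipative lam (mu \x lebesgue_measure)%E (skew_product J pih c)].
Proof.
exists c; split.
- exact: cocycle_of_cocycle.
- exact: level_cocycle_growth.
move=> d' W mu J pih gaussJ gauss_pih.
apply: (skew_product_dissipative gaussJ gauss_pih csc sigma_finite_haar _ _
  measurable_weight weight_gt0 weight_integral_lty).
- exact: cocycle_of_locally_constant.
- exact: cocycle_ofV.
(* At level 0 the cocycle vanishes but the weight is 1, the first alternative; at positive level the
   norm is at least the rate. *)
move=> g; rewrite /weight invrK -levelV//; have [->|g0] := posnP (lev g^-1%g).
  by left; rewrite /rate expr0 invr1.
by right; exact: L2norm_level_cocycle_ge.
Qed.

End level_cocycle.

Theorem proposition9p5 (R : realType) (d : measure_display)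
    (G : topologicalGroupType d) (hG : lcsc_group G)
    (K : nat -> set G)
    (Ksub : forall n, is_subgroup (K n))
    (Kcompact : forall n, compact (K n))
    (Kopen : forall n, open (K n))
    (Kincr : forall n, K n `<=` K n.+1)
    (Kcover : \bigcup_n K n = [set: G])
    (lam : {measure set G -> \bar R}) (hl : left_haar lam) :
  exists c : G -> L2 lam,
    [/\ is_cocycle hl c,
        growth_exponent c = 0%E
      & forall (d' : measure_display) (W : measurableType d')
          (mu : probability W R) (J : L2 lam -> {mfun W >-> R})
          (pih : G -> W -> W),
          gaussian_construction mu J -> gaussian_action hl mu J pih ->
          dissipative lam (mu \x lebesgue_measure)%E (skew_product J pih c)].
Proof.
have [_ _ csc] := hG.
exact: (level_cocycle_exists hl Ksub Kcompact Kopen Kincr Kcover csc).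
Qed.
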